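(* Let $(L,0,1,\oplus)$ be an atomic Archimedean effect algebra for which the tensor product $L\otimes L$ (in the category of effect algebras) exists. If $L$ has the cloning property, then $L$ is a Boolean algebra.
   Context: **Effect algebra.** A quadruple $(L,0,1,\oplus)$ where $L$ is a set with two special elements $0,1$ and $\oplus$ is a partially defined binary operation (write $p\perp q$ when $p\oplus q$ is defined) such that for all $p,q,r\in L$: (i) if $p\perp q$ then $q\perp p$ and $p\oplus q=q\oplus p$; (ii) if $q\perp r$ and $p\perp(q\oplus r)$, then $p\perp q$, $(p\oplus q)\perp r$ and $p\oplus(q\oplus r)=(p\oplus q)\oplus r$; (iii) for every $p\in L$ there is a unique $q\in L$ with $p\perp q$ and $p\oplus q=1$; this $q$ is denoted $p'$; (iv') if $p\perp 1$ then $p=0$. **Order.** $p\le q$ means there is $r\in L$ with $p\perp r$ and $q=p\oplus r$. This is a partial order with least element $0$ and greatest element $1$; $\vee,\wedge$ denote least upper and greatest lower bounds when they exist. For $a\in L$, $[0,a]=\{x\in L: 0\le x\le a\}$. **Atomic.** A non-zero $a\in L$ is an atom if $[0,a]=\{0,a\}$. $L$ is atomic if for every non-zero $p\in L$ there is an atom $a\le p$. **Archimedean.** For $x\in L$ the isotropic index $\iota(x)$ is the maximal nonnegative integer $n$ such that $nx:=x\oplus\cdots\oplus x$ ($n$ times) is defined ($\iota(x)=\infty$ if there is no maximal such $n$). $L$ is Archimedean if $\iota(x)$ is finite for every $x\neq 0$. **Boolean algebra.** An effect algebra $L$ is called a Boolean algebra if the bounded poset $(L,\le,0,1)$ is a distributive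 lattice in which $p'$ is a complement of $p$ for every $p$ (i.e. $p\wedge p'=0$ and $p\vee p'=1$). **Morphism.** A map $\phi:L_1\to L_2$ between effect algebras such that $p\perp q$ implies $\phi(p)\perp\phi(q)$ and $\phi(p\oplus q)=\phi(p)\oplus\phi(q)$, and $\phi(1)=1$. **Bimorphism.** For effect algebras $P,Q,K$, a map $\beta:P\times Q\to K$ such that: if $a\perp b$ in $P$ and $q\in Q$, then $\beta(a,q)\perp\beta(b,q)$ and $\beta(a\oplus b,q)=\beta(a,q)\oplus\beta(b,q)$; if $c\perp d$ in $Q$ and $p\in P$, then $\beta(p,c)\perp\beta(p,d)$ and $\beta(p,c\oplus d)=\beta(p,c)\oplus\beta(p,d)$; and $\beta(1,1)=1$. **Tensor product.** A tensor product of effect algebras $P,Q$ is a pair $(T,\tau)$ with $T$ an effect algebra and $\tau:P\times Q\to T$ a bimorphism such that: (i) for every effect algebra $K$ and every bimorphism $\beta:P\times Q\to K$ there is a morphism $\alpha:T\to K$ with $\beta=\alpha\circ\tau$; (ii) every element of $T$ is a finite orthogonal sum (a defined iterated $\oplus$) of elements of the form $\tau(p,q)$. One writes $P\otimes Q$ for $T$ and $p\otimes q$ for $\tau(p,q)$. **Cloning property.** A cloning map on $L$ is a morphism $\phi:L\otimes L\to L$ with $\phi(p\otimes 1)=\phi(1\otimes p)=p$ for all $p\in L$. $L$ has the cloning property if a cloning map $\phi:L\otimes L\to L$ exists. *)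

(* Defs.v *)
From mathcomp Require Import all_boot.
From mathcomp Require Import boolp classical_sets.

Set Implicit Arguments.
Unset Strict Implicit.
Unset Printing Implicit Defensive.

Local Open Scope classical_set_scope.

(* The partial operation takes values in [option]: [oplus p q = Some r] means
   that p _|_ q and p (+) q = r. The axioms do not demand [zero <> one], so the
   one-element algebra is included. *)
Record effect_algebra := EffectAlgebra {
  ea_sort :> Type;
  zero : ea_sort;
  one : ea_sort;
  oplus : ea_sort -> ea_sort -> option ea_sort;
  oplusC : forall p q r, oplus p q = Some r -> oplus q p = Some r;
  oplusA : forall p q r qr s, oplus q r = Some qr -> oplus p qr = Some s ->
    exists2 pq, oplus p q = Some pq & oplus pq r = Some s;
  orthosupplement_ex : forall p, exists! q, oplus p q = Some one;
  zero_one_law : forall p, oplus p one <> None -> p = zero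
}.

Arguments zero {e}.
Arguments one {e}.
Arguments oplus {e} p q.

Section EffectAlgebra.
Variable L : effect_algebra.
Implicit Types (p q r a x : L) (n : nat).

Definition orthosupplement p : L := sval (cid (orthosupplement_ex p)).

Definition ea_le p q : Prop := exists r, oplus p r = Some q.

Definition ea_initial a : set L := [set x | ea_le zero x /\ ea_le x a].

Definition is_atom a : Prop := a <> zero /\ ea_initial a = [set zero; a].

Definition atomic : Prop :=
  forall p, p <> zero -> exists a, is_atom a /\ ea_le a p.

Fixpoint multiple n x : option L :=
  if n is m.+1 then obind (fun y => oplus y x) (multiple m x) else Some zero.

Definition isotropic_index_is x n : Prop :=
  multiple n x <> None /\ forall m, multiple m x <> None -> m <= n.

Definition archimedean : Prop :=
  forall x, x <> zero -> exists n, isotropic_index_is x n.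

Definition is_glb p q r : Prop :=
  [/\ ea_le r p, ea_le r q & forall x, ea_le x p -> ea_le x q -> ea_le x r].

Definition is_lub p q r : Prop :=
  [/\ ea_le p r, ea_le q r & forall x, ea_le p x -> ea_le q x -> ea_le r x].

Definition is_boolean_algebra : Prop :=
  exists meet join : L -> L -> L,
    [/\ forall p q, is_glb p q (meet p q),
        forall p q, is_lub p q (join p q),
        forall p q r, meet p (join q r) = join (meet p q) (meet p r) &
        forall p, meet p (orthosupplement p) = zero
               /\ join p (orthosupplement p) = one].

Fixpoint orthosum (s : seq L) : option L :=
  if s is x :: s' then obind (oplus x) (orthosum s') else Some zero.

End EffectAlgebra.

Definition is_morphism (L1 L2 : effect_algebra) (phi : L1 -> L2) : Prop :=
  (forall p q r, oplus p q = Some r -> oplus (phi p) (phi q) = Some (phi r))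
  /\ phi one = one.

Definition is_bimorphism (P Q K : effect_algebra) (beta : P -> Q -> K) : Prop :=
  [/\ forall a b c q, oplus a b = Some c ->
        oplus (beta a q) (beta b q) = Some (beta c q),
      forall p c d e, oplus c d = Some e ->
        oplus (beta p c) (beta p d) = Some (beta p e) &
      beta one one = one].

Definition is_tensor_product (P Q T : effect_algebra) (tau : P -> Q -> T)
    : Prop :=
  [/\ is_bimorphism tau,
      forall (K : effect_algebra) (beta : P -> Q -> K), is_bimorphism beta ->
        exists alpha : T -> K,
          is_morphism alpha /\ forall p q, beta p q = alpha (tau p q) &
      forall t : T, exists s : seq (P * Q),
        orthosum [seq tau pq.1 pq.2 | pq <- s] = Some t].

Definition is_cloning_map (L T : effect_algebra) (tau : L -> L -> T)
    (phi : T -> L) : Prop :=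
  is_morphism phi /\ forall p, phi (tau p one) = p /\ phi (tau one p) = p.

(* Relative to a given tensor product [(T, tau)] of [L] with itself; tensor
   products are unique up to isomorphism, so the choice is immaterial. *)
Definition cloning_property (L T : effect_algebra) (tau : L -> L -> T) : Prop :=
  exists phi : T -> L, is_cloning_map tau phi.

(* Main.v *)
From mathcomp Require Import all_boot.
From mathcomp Require Import boolp classical_sets.
Require Import Defs.

Set Implicit Arguments.
Unset Strict Implicit.
Unset Printing Implicit Defensive.

(** A cloning map [phi] yields the bimorphism [b p q = phi (p (x) q)], with
    [b p 1 = b 1 p = p]; hence [b p q] is a lower bound of [p] and [q], and
    [p = b p q (+) b p q'].  If [b x x = 0], then [b (n x) x = 0] for every
    multiple, so [n x <= x'] and [(n+1) x] is defined; in the Archimedean case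
    this forces [x = 0].  Therefore [b a a = a], [b a a' = 0] for every atom
    [a], so no atom is orthogonal to itself, and by atomicity no nonzero element
    is.  It follows that [b p p' = 0], i.e. [b p p = p], so any [x <= p, q]
    satisfies [x = b x x <= b p q]: the bimorphism is the meet, and its
    biadditivity is distributivity. *)

Section EffectAlgebraTheory.
Variable L : effect_algebra.
Implicit Types p q r s x y : L.

Local Notation "p ^'" := (orthosupplement p).

Lemma oplus_suppl p : oplus p p^' = Some one.
Proof. by rewrite /orthosupplement; case: cid => q []. Qed.

Lemma suppl_unique p q : oplus p q = Some one -> q = p^'.
Proof.
case: (orthosupplement_ex p) => r [_ uniq_r] pq.
by rewrite -(uniq_r _ pq) -(uniq_r _ (oplus_suppl p)).
Qed.

Lemma supplK p : (p^')^' = p.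
Proof. by apply/esym/suppl_unique/oplusC/oplus_suppl. Qed.

Lemma suppl1 : (one : L)^' = zero.
Proof. by apply: zero_one_law; rewrite (oplusC (oplus_suppl one)). Qed.

(** Re-bracketing [zero (+) (p (+) p^') = one] makes [zero (+) p] the supplement of [p^'], which is
    [p]. *)
Lemma oplus0l p : oplus zero p = Some p.
Proof.
have h01 : oplus zero one = Some (one : L).
  by rewrite -suppl1; apply/oplusC/oplus_suppl.
have [q zp qp'] := oplusA (oplus_suppl p) h01.
by rewrite zp -(supplK p) (suppl_unique (oplusC qp')).
Qed.

Lemma oplus0r p : oplus p zero = Some p.
Proof. exact/oplusC/oplus0l. Qed.

Lemma oplusA_rev p q r pq s : oplus p q = Some pq -> oplus pq r = Some s ->
  exists2 qr, oplus q r = Some qr & oplus p qr = Some s.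
Proof.
move=> /oplusC qp /oplusC rqp; have [rq h1 h2] := oplusA qp rqp.
by exists rq; apply: oplusC.
Qed.

(** Both [q] and [r] are the supplement of [p (+) s^']. *)
Lemma oplus_cancel p q r s :
  oplus p q = Some s -> oplus p r = Some s -> q = r.
Proof.
move=> /oplusC qp /oplusC rp.
have [u pu qu] := oplusA_rev qp (oplus_suppl s).
have [v pv rv] := oplusA_rev rp (oplus_suppl s).
move: rv; rewrite pu in pv; case: pv => <- ru.
by rewrite (suppl_unique (oplusC qu)) (suppl_unique (oplusC ru)).
Qed.

(** Adding [one] to the vanishing sum and re-bracketing shows that [p] is orthogonal to [one]. *)
Lemma oplus_eq0 p q : oplus p q = Some zero -> p = zero.
Proof.
move=> /oplusC qp; have [r pr _] := oplusA_rev qp (oplus0l one).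
by apply: zero_one_law; rewrite pr.
Qed.

Lemma ea_le_refl p : ea_le p p.
Proof. by exists zero; apply: oplus0r. Qed.

Lemma ea_le_trans q p r : ea_le p q -> ea_le q r -> ea_le p r.
Proof.
by move=> [s ps] [t qt]; have [u _ pu] := oplusA_rev ps qt; exists u.
Qed.

Lemma ea_le_anti p q : ea_le p q -> ea_le q p -> p = q.
Proof.
move=> [s ps] [t qt]; have [u st pu] := oplusA_rev ps qt.
move: st; rewrite (oplus_cancel pu (oplus0r p)) => /oplus_eq0 s0.
by move: ps; rewrite s0 oplus0r => -[].
Qed.

Lemma oplus_lel p q r : oplus p q = Some r -> ea_le p r.
Proof. by exists q. Qed.

Lemma oplus_ler p q r : oplus p q = Some r -> ea_le q r.
Proof. by move=> /oplusC; exists p. Qed.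

Lemma ea_le0 p : ea_le p zero -> p = zero.
Proof. by case=> q /oplus_eq0. Qed.

Lemma suppl_le p q : ea_le p q -> ea_le q^' p^'.
Proof.
move=> [r pr]; have [s rs ps] := oplusA_rev pr (oplus_suppl q).
by rewrite -(suppl_unique ps); apply: oplus_ler rs.
Qed.

Lemma le_suppl_oplus p q : ea_le p q^' -> exists r, oplus p q = Some r.
Proof.
move=> [r /oplusC rp].
have [s pq _] := oplusA_rev rp (oplusC (oplus_suppl q)).
by exists s.
Qed.

Lemma oplus_le_suppl p q r : oplus p q = Some r -> ea_le p q^'.
Proof.
move=> /oplusC qp; have [s ps qs] := oplusA_rev qp (oplus_suppl r).
by rewrite -(suppl_unique qs); apply: oplus_lel ps.
Qed.

Lemma atom_le_cases a x : is_atom a -> ea_le x a -> x = zero \/ x = a.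
Proof.
move=> [_ eq_a] xa.
have : ea_initial a x by split=> //; exists x; apply: oplus0l.
by rewrite eq_a.
Qed.

Section UnitalBimorphism.
Variable b : L -> L -> L.
Hypotheses (b_bi : is_bimorphism b).
Hypotheses (b1r : forall p, b p one = p) (b1l : forall p, b one p = p).

Let bDl p q r x : oplus p q = Some r -> oplus (b p x) (b q x) = Some (b r x).
Proof. by case: b_bi => + _ _; apply. Qed.

Let bDr x p q r : oplus p q = Some r -> oplus (b x p) (b x q) = Some (b x r).
Proof. by case: b_bi => _ + _; apply. Qed.

Lemma bimorphism_mono p q r s :
  ea_le p q -> ea_le r s -> ea_le (b p r) (b q s).
Proof.
move=> [u pu] [v rv].
exact: ea_le_trans (oplus_lel (bDl r pu)) (oplus_lel (bDr q rv)).
Qed.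

Lemma bimorphism_split p q : oplus (b p q) (b p q^') = Some p.
Proof. by rewrite (bDr p (oplus_suppl q)) b1r. Qed.

Lemma bimorphism_lel p q : ea_le (b p q) p.
Proof. exact: oplus_lel (bimorphism_split p q). Qed.

Lemma bimorphism_ler p q : ea_le (b p q) q.
Proof. by have := oplus_lel (bDl q (oplus_suppl p)); rewrite b1l. Qed.

Lemma bimorphism_eq0_le p q : b p q = zero -> ea_le p q^'.
Proof.
move=> pq0; move: (bimorphism_split p q).
by rewrite pq0 oplus0l => -[<-]; apply: bimorphism_ler.
Qed.

Lemma bimorphism_multiple_eq0 x n y :
  b x x = zero -> multiple n x = Some y -> b y x = zero.
Proof.
move=> xx0; elim: n y => [|n IHn] y /=.
  by case=> <-; apply/ea_le0/bimorphism_lel.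
case: (multiple n x) IHn => //= z /(_ z erefl) zx0 /(bDl x).
by rewrite zx0 xx0 oplus0l => -[<-].
Qed.

Hypotheses (L_atomic : atomic L) (L_archimedean : archimedean L).

Lemma bimorphism_diag_eq0 x : b x x = zero -> x = zero.
Proof.
move=> xx0; apply: contrapT => /L_archimedean[n []].
case mult_n: (multiple n x) => [y|] // _ /(_ n.+1).
have [z yx] := le_suppl_oplus
  (bimorphism_eq0_le (bimorphism_multiple_eq0 xx0 mult_n)).
by rewrite /= mult_n /= yx ltnn => max_n; apply/notF/max_n.
Qed.

Lemma self_orthogonal_eq0 p : ea_le p p^' -> p = zero.
Proof.
move=> pp'; apply: contrapT => /L_atomic[a [atom_a ap]].
have aa' : ea_le a a^'.
  exact: ea_le_trans (ea_le_trans ap pp') (suppl_le ap).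
have [a_neq0 _] := atom_a.
have [/bimorphism_diag_eq0//|baa] := atom_le_cases atom_a (bimorphism_lel a a).
apply: a_neq0; rewrite -baa; apply: ea_le0.
(* Now [a = a (+) b a a^'], so [b a a^' = zero] by cancellation; but [a <= a^'] and monotonicity
   give [a = b a a <= b a a^']. *)
have := bimorphism_split a a; rewrite baa => split_a.
rewrite -(oplus_cancel split_a (oplus0r a)) -[X in ea_le X _]baa.
exact: bimorphism_mono (ea_le_refl a) aa'.
Qed.

(** A common lower bound of [p] and [p^'] is orthogonal to itself. *)
Lemma bimorphism_suppl p : b p p^' = zero.
Proof.
apply: self_orthogonal_eq0; apply: ea_le_trans (bimorphism_lel p p^') _.
by rewrite -{1}(supplK p); apply/suppl_le/bimorphism_ler.
Qed.

Lemma bimorphism_idem p : b p p = p.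
Proof.
by move: (bimorphism_split p p); rewrite bimorphism_suppl oplus0r => -[].
Qed.

Lemma bimorphism_glb p q : is_glb p q (b p q).
Proof.
split; [exact: bimorphism_lel | exact: bimorphism_ler | move=> x xp xq].
by rewrite -(bimorphism_idem x); apply: bimorphism_mono.
Qed.

(** De Morgan dual of [bimorphism_glb], the supplement being an order-reversing involution. *)
Lemma bimorphism_lub p q : is_lub p q (b p^' q^')^'.
Proof.
split=> [||x px qx].
- by rewrite -{1}(supplK p); apply/suppl_le/bimorphism_lel.
- by rewrite -{1}(supplK q); apply/suppl_le/bimorphism_ler.
rewrite -(supplK x); apply: suppl_le.
by have [_ _] := bimorphism_glb p^' q^'; apply; apply: suppl_le.
Qed.

(** Splitting [p^'] along [q] in [p (+) p^' = one] gives this. It writes the join as an orthogonal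
    sum, to which additivity of [b] applies. *)
Lemma bimorphism_joinE p q : oplus p (b p^' q) = Some (b p^' q^')^'.
Proof.
have [r pr rq] := oplusA (bimorphism_split p^' q) (oplus_suppl p).
by rewrite pr (suppl_unique (oplusC rq)).
Qed.

(** Orthogonal sums are joins: orthogonality means [q <= p^'], so [b p^' q = q] and
    [bimorphism_joinE] applies. *)
Lemma oplus_le p q r x :
  oplus p q = Some r -> ea_le p x -> ea_le q x -> ea_le r x.
Proof.
move=> pq px qx; have [_ _ lub] := bimorphism_lub p q.
have qp' : ea_le q p^' := oplus_le_suppl (oplusC pq).
have bq : b p^' q = q.
  apply: ea_le_anti; first exact: bimorphism_ler.
  by have [_ _] := bimorphism_glb p^' q; apply => //; apply: ea_le_refl.
by have := bimorphism_joinE p q; rewrite bq pq => -[->]; apply: lub.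
Qed.

Lemma unital_bimorphism_boolean : is_boolean_algebra L.
Proof.
exists b, (fun p q => (b p^' q^')^'); split.
- exact: bimorphism_glb.
- exact: bimorphism_lub.
- move=> p q r; have [pl rl lub] := bimorphism_lub (b p q) (b p r).
  apply: ea_le_anti.
    (* Additivity splits [b p] of the join into [b p q (+) b p (b q^' r)]; the second summand is
       below [b p r], so both lie below the join of [b p q] and [b p r]. *)
    apply: oplus_le (bDr p (bimorphism_joinE q r)) pl _.
    apply: ea_le_trans rl.
    exact: bimorphism_mono (ea_le_refl p) (bimorphism_ler _ _).
  have [qj rj _] := bimorphism_lub q r.
  by apply: lub; apply: bimorphism_mono => //; apply: ea_le_refl.
- move=> p; split; first exact: bimorphism_suppl.
  (* The join of [p] and [p^'] is the supplement of [b p^' (p^')^' = zero]. *)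
  by rewrite bimorphism_suppl -suppl1 supplK.
Qed.

End UnitalBimorphism.
End EffectAlgebraTheory.

Lemma morphism_bimorphism_comp (P Q T K : effect_algebra) (tau : P -> Q -> T)
    (phi : T -> K) : is_bimorphism tau -> is_morphism phi ->
  is_bimorphism (fun p q => phi (tau p q)).
Proof.
move=> [tauDl tauDr tau1] [phiD phi1]; split; last by rewrite tau1.
- by move=> p q r x pq; apply/phiD/tauDl.
- by move=> x p q r pq; apply/phiD/tauDr.
Qed.

Theorem theorem2 (L : effect_algebra) (L_atomic : atomic L)
    (L_archimedean : archimedean L)
    (T : effect_algebra) (tau : L -> L -> T)
    (T_tensor : is_tensor_product tau)
    (L_cloning : cloning_property tau) :
  is_boolean_algebra L.
Proof.
have [tau_bi _ _] := T_tensor.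
have [phi [phi_mor phi_clone]] := L_cloning.
apply: (unital_bimorphism_boolean (morphism_bimorphism_comp tau_bi phi_mor))
  => // p; by have [] := phi_clone p.
Qed.
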